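(* Let $E$ be a pseudo effect algebra with (RDP), and let $t$ be a fixed measure on $E$. Then every measure $m$ on $E$ can be uniquely expressed in the form $m=m_1+m_2$, where $m_1$ and $m_2$ are (finitely additive) measures on $E$ such that $m_1\ll t$, and if $m'$ is any measure on $E$ such that $m'\ll t$ and $m'\le^+m_2$, then $m'=0$.
   Context: A pseudo effect algebra is a partial algebra $(E;+,0,1)$ with a partial binary operation $+$ and constants $0,1$ such that for all $a,b,c\in E$: (i) $a+b$ and $(a+b)+c$ exist iff $b+c$ and $a+(b+c)$ exist, and then $(a+b)+c=a+(b+c)$; (ii) there is exactly one $d$ and exactly one $e$ in $E$ with $a+d=e+a=1$; (iii) if $a+b$ exists, there are $d,e\in E$ with $a+b=d+a=b+e$; (iv) if $1+a$ or $a+1$ exists, then $a=0$. $E$ has (RDP) if whenever $a_1+a_2=b_1+b_2$ (both sums defined), there are $d_1,d_2,d_3,d_4\in E$ with $d_1+d_2=a_1$, $d_3+d_4=a_2$, $d_1+d_3=b_1$, $d_2+d_4=b_2$. A measure on $E$ is a map $m:E\to[0,\infty)$ with $m(a+b)=m(a)+m(b)$ whenever $a+b$ is defined. $m_1\le^+m_2$ means $m_1(a)\le m_2(a)$ for all $a\in E$. For measures $m_1,m_2$, $m_1\ll m_2$ means: $m_2(a)=0$ implies $m_1(a)=0$, for all $a\in E$. *)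

(* Defs.v *)
From mathcomp Require Import all_boot all_order all_algebra.
From mathcomp Require Import reals.

Set Implicit Arguments.
Unset Strict Implicit.
Unset Printing Implicit Defensive.

Import Order.TTheory GRing.Theory Num.Theory.

Local Open Scope ring_scope.

(* The sum [a + b] of the partial algebra is defined, with value [c], iff
   [padd a b = Some c].  [padd_assoc] is an equality of options, so it says at
   once that one side is defined iff the other is and that the values agree. *)
Record pseudoEffectAlgebra := PseudoEffectAlgebra {
  pea_sort :> Type;
  pzero : pea_sort;
  pone : pea_sort;
  padd : pea_sort -> pea_sort -> option pea_sort;
  padd_assoc : forall a b c : pea_sort,
    obind (fun x => padd x c) (padd a b) = obind (fun y => padd a y) (padd b c);
  padd_compl : forall a : pea_sort,
    (exists! d, padd a d = Some pone) /\ (exists! e, padd e a = Some pone);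
  padd_conj : forall a b c : pea_sort, padd a b = Some c ->
    exists d e, padd d a = Some c /\ padd b e = Some c;
  padd_one : forall a : pea_sort,
    padd pone a <> None \/ padd a pone <> None -> a = pzero
}.

Definition RDP (E : pseudoEffectAlgebra) : Prop :=
  forall a1 a2 b1 b2 c : E, padd a1 a2 = Some c -> padd b1 b2 = Some c ->
    exists d1 d2 d3 d4 : E,
      [/\ padd d1 d2 = Some a1, padd d3 d4 = Some a2,
          padd d1 d3 = Some b1 & padd d2 d4 = Some b2].

Section Measures.
Variables (R : realType) (E : pseudoEffectAlgebra).
Implicit Types m : E -> R.

Definition is_measure m : Prop :=
  (forall a, 0 <= m a) /\
  (forall a b c, padd a b = Some c -> m c = m a + m b).

Definition measure_le m1 m2 : Prop := forall a, m1 a <= m2 a.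

Definition abs_continuous m1 m2 : Prop := forall a, m2 a = 0 -> m1 a = 0.

End Measures.

(* Main.v *)
Require Import Defs.
From mathcomp Require Import all_boot all_order all_algebra.
From mathcomp Require Import boolp classical_sets reals.
From mathcomp Require Import lra.

(** The component [m2] singular to [t] is explicit: [m2 a] is the supremum of
    [m z] over the [t]-null [z] below [a].  (RDP) gives its subadditivity;
    superadditivity holds because moving a summand past another one replaces it
    by an element on which every measure takes the same value.  On [t]-null
    elements [m2] coincides with [m], so [m - m2] is absolutely continuous.  For
    any other decomposition [(n1, n2)], [n2 = m] on [t]-null elements, whence
    [m2 <= n2], and [n2 - m2 = m1 - n1] is an absolutely continuous measure
    below [n2], hence zero. *)

Import Order.TTheory GRing.Theory Num.Theory.

Local Open Scope ring_scope.

Lemma padd_assocl {E : pseudoEffectAlgebra} {a b c x y : E} :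
  padd a b = Some x -> padd x c = Some y ->
  exists2 v, padd b c = Some v & padd a v = Some y.
Proof.
move=> abx xcy; have := padd_assoc a b c; rewrite abx /= xcy.
by case: (padd b c) => [v|] //= /esym ?; exists v.
Qed.

Lemma padd_assocr {E : pseudoEffectAlgebra} {a b c x y : E} :
  padd b c = Some x -> padd a x = Some y ->
  exists2 v, padd a b = Some v & padd v c = Some y.
Proof.
move=> bcx axy; have := padd_assoc a b c; rewrite bcx /= axy.
by case: (padd a b) => [v|] //= ?; exists v.
Qed.

Lemma padd1z (E : pseudoEffectAlgebra) :
  padd (pone E) (pzero E) = Some (pone E).
Proof.
have [[d [d1 _]] _] := padd_compl (pone E).
by rewrite -(@padd_one _ d) //; left; rewrite d1.
Qed.

Lemma paddz1 (E : pseudoEffectAlgebra) :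
  padd (pzero E) (pone E) = Some (pone E).
Proof.
have [_ [e [e1 _]]] := padd_compl (pone E).
by rewrite -(@padd_one _ e) //; right; rewrite e1.
Qed.

Lemma paddz {E : pseudoEffectAlgebra} (a : E) : padd a (pzero E) = Some a.
Proof.
have [_ [e [ea _]]] := padd_compl a.
have [x ax ex] := padd_assocl ea (padd1z E).
have [[d [_ ud]] _] := padd_compl e.
by rewrite ax -(ud _ ex) (ud _ ea).
Qed.

Lemma zpadd {E : pseudoEffectAlgebra} (a : E) : padd (pzero E) a = Some a.
Proof.
have [[d [ad _]] _] := padd_compl a.
have [x ax xd] := padd_assocr ad (paddz1 E).
have [_ [e [_ ue]]] := padd_compl d.
by rewrite ax -(ue _ xd) (ue _ ad).
Qed.

Section Measures.
Context {R : realType} {E : pseudoEffectAlgebra}.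
Implicit Types (m t : E -> R) (a b c z w : E).

Lemma measure0 {m} : is_measure m -> m (pzero E) = 0.
Proof. by case=> _ /(_ _ _ _ (zpadd (pzero E))) ?; lra. Qed.

Lemma measure_summand_le {m z w a} :
  is_measure m -> padd z w = Some a -> m z <= m a.
Proof. by case=> m0 mD /mD ->; rewrite lerDl. Qed.

Lemma measure_sub {m1 m2} :
  is_measure m1 -> is_measure m2 -> measure_le m2 m1 ->
  is_measure (fun a => m1 a - m2 a).
Proof.
move=> [_ m1D] [_ m2D] le21; split=> [a|a b c abc].
  by rewrite subr_ge0.
by rewrite (m1D _ _ _ abc) (m2D _ _ _ abc); lra.
Qed.

Definition null_summand t a : set E :=
  [set z | t z = 0 /\ exists w, padd z w = Some a]%classic.

Definition singular_part t m a : R := sup (m @` null_summand t a)%classic.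

Lemma singular_part_ub {t m a z w} : is_measure m ->
  t z = 0 -> padd z w = Some a -> m z <= singular_part t m a.
Proof.
move=> mm tz zwa; apply: ub_le_sup; last by exists z => //; split=> //; exists w.
by exists (m a) => _ [y [_ [v yva]] <-]; exact: measure_summand_le yva.
Qed.

Lemma singular_part_le {t m a} {k : R} : is_measure t ->
  (forall z w, t z = 0 -> padd z w = Some a -> m z <= k) ->
  singular_part t m a <= k.
Proof.
move=> mt le_k; apply: ge_sup.
  exists (m (pzero E)), (pzero E) => //.
  by split; [exact: measure0 | exists a; exact: zpadd].
by move=> _ [z [tz [w zwa]] <-]; exact: le_k tz zwa.
Qed.

Lemma singular_part_le_measure {t m} :
  is_measure t -> is_measure m -> measure_le (singular_part t m) m.
Proof.
move=> mt mm a; apply: singular_part_le => // z w _.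
exact: measure_summand_le.
Qed.

Lemma singular_part_null {t m a} : is_measure t -> is_measure m ->
  t a = 0 -> singular_part t m a = m a.
Proof.
move=> mt mm ta; apply/eqP; rewrite eq_le singular_part_le_measure //=.
exact: singular_part_ub ta (paddz a).
Qed.

Lemma null_summand_add {t m a b c z1 w1 z2 w2} :
  is_measure t -> is_measure m -> padd a b = Some c ->
  t z1 = 0 -> padd z1 w1 = Some a -> t z2 = 0 -> padd z2 w2 = Some b ->
  exists u v, [/\ padd u v = Some c, t u = 0 & m u = m z1 + m z2].
Proof.
move=> [_ tD] [_ mD] abc tz1 zw1 tz2 zw2.
have [y w1b z1y] := padd_assocl zw1 abc.
have [x w1z2 xw2] := padd_assocr zw2 w1b.
have [d [_ [dw1 _]]] := padd_conj w1z2.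
have [v _ dv] := padd_assocl dw1 xw2.
have [u z1d uv] := padd_assocr dv z1y.
exists u, v; split=> //.
- have := tD _ _ _ w1z2; have := tD _ _ _ dw1; have := tD _ _ _ z1d; lra.
- have := mD _ _ _ w1z2; have := mD _ _ _ dw1; have := mD _ _ _ z1d; lra.
Qed.

Lemma singular_part_measure {t m} : RDP E -> is_measure t -> is_measure m ->
  is_measure (singular_part t m).
Proof.
move=> rdp mt mm; split=> [a|a b c abc].
  rewrite -(measure0 mm).
  exact: singular_part_ub (measure0 mt) (zpadd a).
apply/eqP; rewrite eq_le; apply/andP; split.
  apply: singular_part_le => // z w tz zwc.
  have [d1 [d2 [d3 [d4 [d12 d34 d13 d24]]]]] := rdp _ _ _ _ _ zwc abc.
  have [t0 tD] := mt; have := tD _ _ _ d12; rewrite tz => td.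
  have td1 : t d1 = 0 by have := t0 d1; have := t0 d2; lra.
  have td2 : t d2 = 0 by lra.
  rewrite (mm.2 _ _ _ d12).
  by apply: lerD; [exact: singular_part_ub d13 | exact: singular_part_ub d24].
rewrite -lerBrDr; apply: singular_part_le => // z1 w1 tz1 zw1.
rewrite lerBrDl -lerBrDr; apply: singular_part_le => // z2 w2 tz2 zw2.
have [u [v [uvc tu mu]]] := null_summand_add mt mm abc tz1 zw1 tz2 zw2.
by rewrite lerBrDr addrC -mu; exact: singular_part_ub uvc.
Qed.

Lemma singular_part_singular {t m m'} : is_measure t -> is_measure m ->
  is_measure m' -> abs_continuous m' t -> measure_le m' (singular_part t m) ->
  is_measure (singular_part t m) -> forall a, m' a = 0.
Proof.
move=> mt mm mm' ac le_m' [_ sD] a; apply/eqP; rewrite eq_le mm'.1 andbT.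
suff : singular_part t m a <= singular_part t m a - m' a by lra.
apply: singular_part_le => // z w tz zwa.
have := mm'.2 _ _ _ zwa; have := sD _ _ _ zwa; have := le_m' w.
rewrite (ac _ tz) (@singular_part_null t m z) //; lra.
Qed.

End Measures.

Theorem theorem4p9 (R : realType) (E : pseudoEffectAlgebra) (hE : RDP E)
    (t : E -> R) (ht : is_measure t) (m : E -> R) (hm : is_measure m) :
  exists! m12 : (E -> R) * (E -> R),
    [/\ is_measure m12.1,
        is_measure m12.2,
        (forall a : E, m a = m12.1 a + m12.2 a),
        abs_continuous m12.1 t
      & forall m' : E -> R, is_measure m' -> abs_continuous m' t ->
          measure_le m' m12.2 -> forall a : E, m' a = 0].
Proof.
have hs := singular_part_measure hE ht hm.
have le_sm := singular_part_le_measure ht hm.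
exists (fun a => m a - singular_part t m a, singular_part t m); split=> /=.
  split=> //.
  - exact: measure_sub.
  - by move=> a; rewrite subrK.
  - by move=> a ta; rewrite singular_part_null // subrr.
  - by move=> m' *; exact: (@singular_part_singular _ _ t m m').
move=> [n1 n2] /= [n1m n2m mE n1t n2s].
have n2_null z : t z = 0 -> n2 z = m z by move=> tz; rewrite mE n1t // add0r.
have le_sn2 : measure_le (singular_part t m) n2.
  move=> a; apply: singular_part_le => // z w tz zwa.
  by rewrite -n2_null //; exact: measure_summand_le zwa.
have n2E a : n2 a = singular_part t m a.
  apply/eqP; rewrite -subr_eq0; apply/eqP; move: a.
  apply: n2s; first exact: measure_sub.
  - by move=> a ta; rewrite n2_null // singular_part_null // subrr.
  - by move=> a; rewrite lerBlDr lerDl; exact: hs.1.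
by congr pair; apply/funext => a; rewrite ?mE n2E ?addrK.
Qed.
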